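(* Let $\Gamma$ be a well-formed EPTS context (of a functional PTS specification) and $M$ a Dedukti term in $\beta$-normal form. If $[\![\Gamma]\!]\vdash_{DK}M:\Pi x:A.B$, then $M=\lambda x:A'.N$ for some $A',N$ with $A'\equiv A$ and $[\![\Gamma]\!],x:A\vdash_{DK}N:B$.
   Context: Functional PTS specification $(\mathcal S,\mathcal A,\mathcal R)$ and its EPTS (terms $x\mid s\mid\Pi_{s_1,s_2}(A,x.B)\mid\lambda_{s_1,s_2}(A,x.B,x.M)\mid@_{s_1,s_2}(A,x.B,M,N)$, typing with sorts, products of sort triple in $\mathcal R$, explicit abstraction and application). $\vdash_{DK}$ is Dedukti typing ($\lambda\Pi$-calculus with constants, conversion $\equiv$ modulo $\beta$ and rewrite rules) in the theory $(\Sigma_{EPTS},\mathscr R_{EPTS})$: $\mathbf U_s:\mathtt{TYPE}$, $\mathbf{El}_s[A:\mathbf U_s]:\mathtt{TYPE}$; for $(s_1,s_2)\in\mathcal A$, $\mathbf u_{s_1}:\mathbf U_{s_2}$ and rule $\mathbf{El}_{s_2}\mathbf u_{s_1}\hookrightarrow\mathbf U_{s_1}$; for $(s_1,s_2,s_3)\in\mathcal R$, $\mathbf{Prod}_{s_1,s_2}[A:\mathbf U_{s_1};B:\mathbf{El}_{s_1}A\to\mathbf U_{s_2}]:\mathbf U_{s_3}$, $\mathbf{abs}_{s_1,s_2}[A;B;M:\Pi x:\mathbf{El}_{s_1}A.\mathbf{El}_{s_2}(Bx)]:\mathbf{El}_{s_3}(\mathbf{Prod}_{s_1,s_2}AB)$,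 $\mathbf{app}_{s_1,s_2}[A;B;M:\mathbf{El}_{s_3}(\mathbf{Prod}_{s_1,s_2}AB);N:\mathbf{El}_{s_1}A]:\mathbf{El}_{s_2}(BN)$ and rule $\mathbf{app}_{s_1,s_2}AB(\mathbf{abs}_{s_1,s_2}A'B'M)N\hookrightarrow MN$. Context translation: $[\![-]\!]=-$, $[\![\Gamma,x:A]\!]=[\![\Gamma]\!],x:\mathbf{El}_{s_A}[\![A]\!]$ where $\Gamma\vdash A:s_A$, with $[\![A]\!]$ the term translation ($x\mapsto x$, $s\mapsto\mathbf u_s$, $\Pi_{s_1,s_2}(A,x.B)\mapsto\mathbf{Prod}_{s_1,s_2}[\![A]\!](\lambda x:\mathbf{El}_{s_1}[\![A]\!].[\![B]\!])$, $\lambda_{s_1,s_2}(A,x.B,x.M)\mapsto\mathbf{abs}_{s_1,s_2}[\![A]\!](\lambda x:\mathbf{El}_{s_1}[\![A]\!].[\![B]\!])(\lambda x:\mathbf{El}_{s_1}[\![A]\!].[\![M]\!])$, $@_{s_1,s_2}(A,x.B,M,N)\mapsto\mathbf{app}_{s_1,s_2}[\![A]\!](\lambda x:\mathbf{El}_{s_1}[\![A]\!].[\![B]\!])[\![M]\!][\![N]\!]$). *)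

(* Defs.v *)
(* Binders are de Bruijn indices throughout; contexts are lists
   with the most recent declaration at the head, each type living in the
   context formed by the tail. *)
From Stdlib Require Import List Relations.
Import ListNotations.

Set Implicit Arguments.

(* Constants carry the list of their arguments; the arity of a constant is
   enforced by typing, through the length of its context in the signature. *)
Inductive term (C : Type) : Type :=
| Var (n : nat)
| Cst (c : C) (Ms : list (term C))
| TYPE
| KIND
| Pi (A B : term C)
| Lam (A M : term C)
| App (M N : term C).

Arguments Var {C} n.
Arguments TYPE {C}.
Arguments KIND {C}.

Definition ctx (C : Type) : Type := list (term C).

Definition up_ren (xi : nat -> nat) (n : nat) : nat :=
  match n with 0 => 0 | S m => S (xi m) end.

Fixpoint rename {C : Type} (xi : nat -> nat) (t : term C) : term C :=
  match t with
  | Var n => Var (xi n)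
  | Cst c Ms => Cst c (map (rename xi) Ms)
  | TYPE => TYPE
  | KIND => KIND
  | Pi A B => Pi (rename xi A) (rename (up_ren xi) B)
  | Lam A M => Lam (rename xi A) (rename (up_ren xi) M)
  | App M N => App (rename xi M) (rename xi N)
  end.

Definition up_sub {C : Type} (sigma : nat -> term C) (n : nat) : term C :=
  match n with 0 => Var 0 | S m => rename S (sigma m) end.

Fixpoint subst {C : Type} (sigma : nat -> term C) (t : term C) : term C :=
  match t with
  | Var n => sigma n
  | Cst c Ms => Cst c (map (subst sigma) Ms)
  | TYPE => TYPE
  | KIND => KIND
  | Pi A B => Pi (subst sigma A) (subst (up_sub sigma) B)
  | Lam A M => Lam (subst sigma A) (subst (up_sub sigma) M)
  | App M N => App (subst sigma M) (subst sigma N)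
  end.

Definition scons {T : Type} (t : T) (sigma : nat -> T) (n : nat) : T :=
  match n with 0 => t | S m => sigma m end.

Definition subst1 {C : Type} (M N : term C) : term C := subst (scons N Var) M.

(* [Ms] lists the arguments in declaration order [M_1; ...; M_n], so that index
   0 (the last declared parameter) is mapped to [M_n]. *)
Definition args_sub {C : Type} (Ms : list (term C)) : nat -> term C :=
  fold_left (fun sigma M => scons M sigma) Ms Var.

(* [sig c Delta A] means that [c[Delta] : A] is in the signature. The free
   variables of a rule [rules l r] are its pattern variables. *)
Record theory (C : Type) : Type := Theory {
  sig : C -> ctx C -> term C -> Prop;
  rules : term C -> term C -> Prop
}.

Inductive compat {C : Type} (R : relation (term C)) : relation (term C) :=
| compat_root M N : R M N -> compat R M N
| compat_Cst c Ms M M' Ns : compat R M M' ->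
    compat R (Cst c (Ms ++ M :: Ns)) (Cst c (Ms ++ M' :: Ns))
| compat_Pi_l A A' B : compat R A A' -> compat R (Pi A B) (Pi A' B)
| compat_Pi_r A B B' : compat R B B' -> compat R (Pi A B) (Pi A B')
| compat_Lam_l A A' M : compat R A A' -> compat R (Lam A M) (Lam A' M)
| compat_Lam_r A M M' : compat R M M' -> compat R (Lam A M) (Lam A M')
| compat_App_l M M' N : compat R M M' -> compat R (App M N) (App M' N)
| compat_App_r M N N' : compat R N N' -> compat R (App M N) (App M N').

Inductive beta_root {C : Type} : relation (term C) :=
| beta_root_intro A M N : beta_root (App (Lam A M) N) (subst1 M N).

Inductive rule_root {C : Type} (T : theory C) : relation (term C) :=
| rule_root_intro l r sigma : rules T l r ->
    rule_root T (subst sigma l) (subst sigma r).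

Definition beta_step {C : Type} : relation (term C) := compat beta_root.

Definition beta_normal {C : Type} (M : term C) : Prop :=
  forall M', ~ beta_step M M'.

Definition conv {C : Type} (T : theory C) : relation (term C) :=
  clos_refl_sym_trans _ (compat (union _ beta_root (rule_root T))).

Definition is_sort {C : Type} (s : term C) : Prop := s = TYPE \/ s = KIND.

(* [dk_args T G Ms Delta]: the list [Ms] instantiates the context [Delta]. *)
Inductive dk_wf {C : Type} (T : theory C) : ctx C -> Prop :=
| dk_wf_nil : dk_wf T []
| dk_wf_cons G A : dk_typing T G A TYPE -> dk_wf T (A :: G)

with dk_typing {C : Type} (T : theory C) : ctx C -> term C -> term C -> Prop :=
| dk_Var G n A :
    dk_wf T G -> nth_error G n = Some A ->
    dk_typing T G (Var n) (rename (Nat.add (S n)) A)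
| dk_Cst G c Delta A s Ms :
    sig T c Delta A -> is_sort s -> dk_typing T Delta A s ->
    dk_args T G Ms Delta ->
    dk_typing T G (Cst c Ms) (subst (args_sub Ms) A)
| dk_Sort G :
    dk_wf T G -> dk_typing T G TYPE KIND
| dk_Pi G A B s :
    is_sort s -> dk_typing T G A TYPE -> dk_typing T (A :: G) B s ->
    dk_typing T G (Pi A B) s
| dk_Lam G A B M s :
    is_sort s -> dk_typing T G A TYPE -> dk_typing T (A :: G) B s ->
    dk_typing T (A :: G) M B ->
    dk_typing T G (Lam A M) (Pi A B)
| dk_App G A B M N :
    dk_typing T G M (Pi A B) -> dk_typing T G N A ->
    dk_typing T G (App M N) (subst1 B N)
| dk_Conv G M A B s :
    is_sort s -> dk_typing T G M A -> dk_typing T G B s -> conv T A B ->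
    dk_typing T G M B

with dk_args {C : Type} (T : theory C) : ctx C -> list (term C) -> ctx C -> Prop :=
| dk_args_nil G : dk_wf T G -> dk_args T G [] []
| dk_args_snoc G Ms Delta M A :
    dk_args T G Ms Delta -> dk_typing T G M (subst (args_sub Ms) A) ->
    dk_args T G (Ms ++ [M]) (A :: Delta).

Record pts_spec : Type := PtsSpec {
  sort : Type;
  axiom : sort -> sort -> Prop;
  prod_rule : sort -> sort -> sort -> Prop
}.

Definition functional (P : pts_spec) : Prop :=
  (forall s1 s2 s2', axiom P s1 s2 -> axiom P s1 s2' -> s2 = s2') /\
  (forall s1 s2 s3 s3',
     prod_rule P s1 s2 s3 -> prod_rule P s1 s2 s3' -> s3 = s3').

(* The arguments written [x.B] and [x.M] on paper bind index 0. *)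
Inductive eterm (S : Type) : Type :=
| EVar (n : nat)
| ESort (s : S)
| EPi (s1 s2 : S) (A B : eterm S)
| ELam (s1 s2 : S) (A B M : eterm S)
| EApp (s1 s2 : S) (A B M N : eterm S).

Arguments EVar {S} n.

Definition ectx (S : Type) : Type := list (eterm S).

Fixpoint erename {S : Type} (xi : nat -> nat) (t : eterm S) : eterm S :=
  match t with
  | EVar n => EVar (xi n)
  | ESort s => ESort s
  | EPi s1 s2 A B => EPi s1 s2 (erename xi A) (erename (up_ren xi) B)
  | ELam s1 s2 A B M =>
      ELam s1 s2 (erename xi A) (erename (up_ren xi) B) (erename (up_ren xi) M)
  | EApp s1 s2 A B M N =>
      EApp s1 s2 (erename xi A) (erename (up_ren xi) B)
           (erename xi M) (erename xi N)
  end.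

Definition eup_sub {S : Type} (sigma : nat -> eterm S) (n : nat) : eterm S :=
  match n with 0 => EVar 0 | Datatypes.S m => erename Datatypes.S (sigma m) end.

Fixpoint esubst {S : Type} (sigma : nat -> eterm S) (t : eterm S) : eterm S :=
  match t with
  | EVar n => sigma n
  | ESort s => ESort s
  | EPi s1 s2 A B => EPi s1 s2 (esubst sigma A) (esubst (eup_sub sigma) B)
  | ELam s1 s2 A B M =>
      ELam s1 s2 (esubst sigma A) (esubst (eup_sub sigma) B)
           (esubst (eup_sub sigma) M)
  | EApp s1 s2 A B M N =>
      EApp s1 s2 (esubst sigma A) (esubst (eup_sub sigma) B)
           (esubst sigma M) (esubst sigma N)
  end.

Definition esubst1 {S : Type} (M N : eterm S) : eterm S :=
  esubst (scons N EVar) M.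

Inductive estep {S : Type} : relation (eterm S) :=
| estep_beta s1 s2 A B A' B' M N :
    estep (EApp s1 s2 A B (ELam s1 s2 A' B' M) N) (esubst1 M N)
| estep_Pi_1 s1 s2 A A' B :
    estep A A' -> estep (EPi s1 s2 A B) (EPi s1 s2 A' B)
| estep_Pi_2 s1 s2 A B B' :
    estep B B' -> estep (EPi s1 s2 A B) (EPi s1 s2 A B')
| estep_Lam_1 s1 s2 A A' B M :
    estep A A' -> estep (ELam s1 s2 A B M) (ELam s1 s2 A' B M)
| estep_Lam_2 s1 s2 A B B' M :
    estep B B' -> estep (ELam s1 s2 A B M) (ELam s1 s2 A B' M)
| estep_Lam_3 s1 s2 A B M M' :
    estep M M' -> estep (ELam s1 s2 A B M) (ELam s1 s2 A B M')
| estep_App_1 s1 s2 A A' B M N :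
    estep A A' -> estep (EApp s1 s2 A B M N) (EApp s1 s2 A' B M N)
| estep_App_2 s1 s2 A B B' M N :
    estep B B' -> estep (EApp s1 s2 A B M N) (EApp s1 s2 A B' M N)
| estep_App_3 s1 s2 A B M M' N :
    estep M M' -> estep (EApp s1 s2 A B M N) (EApp s1 s2 A B M' N)
| estep_App_4 s1 s2 A B M N N' :
    estep N N' -> estep (EApp s1 s2 A B M N) (EApp s1 s2 A B M N').

Definition econv {S : Type} : relation (eterm S) :=
  clos_refl_sym_trans _ estep.

Inductive epts_wf (P : pts_spec) : ectx (sort P) -> Prop :=
| epts_wf_nil : epts_wf P []
| epts_wf_cons G A s : epts_typing P G A (ESort s) -> epts_wf P (A :: G)

with epts_typing (P : pts_spec) :
    ectx (sort P) -> eterm (sort P) -> eterm (sort P) -> Prop :=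
| epts_Var G n A :
    epts_wf P G -> nth_error G n = Some A ->
    epts_typing P G (EVar n) (erename (Nat.add (S n)) A)
| epts_Sort G s1 s2 :
    epts_wf P G -> axiom P s1 s2 ->
    epts_typing P G (ESort s1) (ESort s2)
| epts_Pi G A B s1 s2 s3 :
    prod_rule P s1 s2 s3 ->
    epts_typing P G A (ESort s1) -> epts_typing P (A :: G) B (ESort s2) ->
    epts_typing P G (EPi s1 s2 A B) (ESort s3)
| epts_Lam G A B M s1 s2 s3 :
    prod_rule P s1 s2 s3 ->
    epts_typing P G A (ESort s1) -> epts_typing P (A :: G) B (ESort s2) ->
    epts_typing P (A :: G) M B ->
    epts_typing P G (ELam s1 s2 A B M) (EPi s1 s2 A B)
| epts_App G A B M N s1 s2 s3 :
    prod_rule P s1 s2 s3 ->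
    epts_typing P G A (ESort s1) -> epts_typing P (A :: G) B (ESort s2) ->
    epts_typing P G M (EPi s1 s2 A B) -> epts_typing P G N A ->
    epts_typing P G (EApp s1 s2 A B M N) (esubst1 B N)
| epts_Conv G M A B s :
    epts_typing P G M A -> epts_typing P G B (ESort s) -> econv A B ->
    epts_typing P G M B.

Inductive econst (S : Type) : Type :=
| cU (s : S)
| cEl (s : S)
| cu (s : S)
| cProd (s1 s2 : S)
| cabs (s1 s2 : S)
| capp (s1 s2 : S).

Definition tU {S : Type} (s : S) : term (econst S) := Cst (cU s) [].

Definition tEl {S : Type} (s : S) (A : term (econst S)) : term (econst S) :=
  Cst (cEl s) [A].

Definition tu {S : Type} (s : S) : term (econst S) := Cst (cu s) [].

Definition tProd {S : Type} (s1 s2 : S) (A B : term (econst S))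
    : term (econst S) :=
  Cst (cProd s1 s2) [A; B].

Definition tabs {S : Type} (s1 s2 : S) (A B M : term (econst S))
    : term (econst S) :=
  Cst (cabs s1 s2) [A; B; M].

Definition tapp {S : Type} (s1 s2 : S) (A B M N : term (econst S))
    : term (econst S) :=
  Cst (capp s1 s2) [A; B; M; N].

(* The parameter contexts are listed from the last parameter to the first. *)
Inductive epts_sig (P : pts_spec) :
    econst (sort P) -> ctx (econst (sort P)) -> term (econst (sort P)) -> Prop :=
| sig_U s : epts_sig P (cU s) [] TYPE
| sig_El s : epts_sig P (cEl s) [tU s] TYPE
| sig_u s1 s2 : axiom P s1 s2 -> epts_sig P (cu s1) [] (tU s2)
| sig_Prod s1 s2 s3 : prod_rule P s1 s2 s3 ->
    epts_sig P (cProd s1 s2)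
      [Pi (tEl s1 (Var 0)) (tU s2);
       tU s1]
      (tU s3)
| sig_abs s1 s2 s3 : prod_rule P s1 s2 s3 ->
    epts_sig P (cabs s1 s2)
      [Pi (tEl s1 (Var 1)) (tEl s2 (App (Var 1) (Var 0)));
       Pi (tEl s1 (Var 0)) (tU s2);
       tU s1]
      (tEl s3 (tProd s1 s2 (Var 2) (Var 1)))
| sig_app s1 s2 s3 : prod_rule P s1 s2 s3 ->
    epts_sig P (capp s1 s2)
      [tEl s1 (Var 2);
       tEl s3 (tProd s1 s2 (Var 1) (Var 0));
       Pi (tEl s1 (Var 0)) (tU s2);
       tU s1]
      (tEl s2 (App (Var 2) (Var 0))).

Inductive epts_rules (P : pts_spec) :
    term (econst (sort P)) -> term (econst (sort P)) -> Prop :=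
| rule_El s1 s2 : axiom P s1 s2 ->
    epts_rules P (tEl s2 (tu s1)) (tU s1)
| rule_app s1 s2 s3 : prod_rule P s1 s2 s3 ->
    epts_rules P
      (tapp s1 s2 (Var 0) (Var 1)
            (tabs s1 s2 (Var 2) (Var 3) (Var 4)) (Var 5))
      (App (Var 4) (Var 5)).

Definition epts_theory (P : pts_spec) : theory (econst (sort P)) :=
  Theory (epts_sig P) (epts_rules P).

Fixpoint tr {S : Type} (t : eterm S) : term (econst S) :=
  match t with
  | EVar n => Var n
  | ESort s => tu s
  | EPi s1 s2 A B => tProd s1 s2 (tr A) (Lam (tEl s1 (tr A)) (tr B))
  | ELam s1 s2 A B M =>
      tabs s1 s2 (tr A) (Lam (tEl s1 (tr A)) (tr B)) (Lam (tEl s1 (tr A)) (tr M))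
  | EApp s1 s2 A B M N =>
      tapp s1 s2 (tr A) (Lam (tEl s1 (tr A)) (tr B)) (tr M) (tr N)
  end.

(* A relation, because the sort [s_A] annotating [El] is read off a typing
   judgement; it is total on well-formed contexts, and the sort is unique when
   the specification is functional. *)
Inductive ctx_tr (P : pts_spec) :
    ectx (sort P) -> ctx (econst (sort P)) -> Prop :=
| ctx_tr_nil : ctx_tr P [] []
| ctx_tr_cons G D A s :
    ctx_tr P G D -> epts_typing P G A (ESort s) ->
    ctx_tr P (A :: G) (tEl s (tr A) :: D).

(* Main.v *)
(** [El], [U], [TYPE] and [KIND] heads are stable under reduction, so by
    confluence no type with such a head is convertible to a product. In a
    translated context every variable, every constant and every sort or product
    has a type of this kind; hence the head of a beta-normal application would
    have to be an abstraction, and only abstractions can inhabit a product.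
    Confluence (parallel reduction has the diamond property, since the rules are
    orthogonal) also yields injectivity of [Pi], and conversion of the bound
    variable's type gives the typing of the body. *)
Require Import Defs.
From Stdlib Require Import List Relations Lia.
Import ListNotations.

Set Implicit Arguments.

(** * Substitution *)

(** The arguments of [Cst] are nested in a list; an inner fixpoint supplies the induction hypothesis
    for them as a [Forall]. *)
Fixpoint term_list_ind (C : Type) (Q : term C -> Prop)
    (hVar : forall n, Q (Var n))
    (hCst : forall c Ms, Forall Q Ms -> Q (Cst c Ms))
    (hTYPE : Q TYPE) (hKIND : Q KIND)
    (hPi : forall A B, Q A -> Q B -> Q (Pi A B))
    (hLam : forall A M, Q A -> Q M -> Q (Lam A M))
    (hApp : forall M N, Q M -> Q N -> Q (App M N)) (t : term C) : Q t :=
  let ind := @term_list_ind C Q hVar hCst hTYPE hKIND hPi hLam hApp in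
  match t with
  | Var n => hVar n
  | Cst c Ms =>
      hCst c Ms ((fix inds (l : list (term C)) : Forall Q l :=
                 match l with
                 | [] => Forall_nil Q
                 | M :: l' => Forall_cons M (ind M) (inds l')
                 end) Ms)
  | TYPE => hTYPE
  | KIND => hKIND
  | Pi A B => hPi _ _ (ind A) (ind B)
  | Lam A M => hLam _ _ (ind A) (ind M)
  | App M N => hApp _ _ (ind M) (ind N)
  end.

Section Substitution.

Variable C : Type.
Implicit Types (t M N A B : term C) (Ms : list (term C)) (sigma tau : nat -> term C).

Lemma up_sub_ext sigma tau :
  (forall n, sigma n = tau n) -> forall n, up_sub sigma n = up_sub tau n.
Proof. intros H [|n]; simpl; now rewrite ?H. Qed.

Lemma subst_ext t : forall sigma tau,
  (forall n, sigma n = tau n) -> subst sigma t = subst tau t.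
Proof.
  induction t as [n|c Ms IH| | |A B IHA IHB|A M IHA IHM|M N IHM IHN]
    using term_list_ind; intros sigma tau H; simpl; auto.
  - f_equal; apply map_ext_Forall; revert IH; apply Forall_impl; auto.
  - f_equal; auto using up_sub_ext.
  - f_equal; auto using up_sub_ext.
  - f_equal; auto.
Qed.

Lemma rename_subst t : forall xi, rename xi t = subst (fun n => Var (xi n)) t.
Proof.
  assert (up : forall xi n,
            up_sub (fun m => Var (xi m) : term C) n = Var (up_ren xi n))
    by (intros xi [|n]; reflexivity).
  induction t as [n|c Ms IH| | |A B IHA IHB|A M IHA IHM|M N IHM IHN]
    using term_list_ind; intros xi; simpl; auto.
  - f_equal; apply map_ext_Forall; revert IH; apply Forall_impl; auto.
  - f_equal; auto; rewrite IHB; apply subst_ext; auto.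
  - f_equal; auto; rewrite IHM; apply subst_ext; auto.
  - f_equal; auto.
Qed.

Lemma subst_rename t : forall sigma xi,
  subst sigma (rename xi t) = subst (fun n => sigma (xi n)) t.
Proof.
  induction t as [n|c Ms IH| | |A B IHA IHB|A M IHA IHM|M N IHM IHN]
    using term_list_ind; intros sigma xi; simpl; auto.
  - f_equal; rewrite map_map; apply map_ext_Forall; revert IH; apply Forall_impl; auto.
  - f_equal; auto; rewrite IHB; apply subst_ext; intros [|n]; reflexivity.
  - f_equal; auto; rewrite IHM; apply subst_ext; intros [|n]; reflexivity.
  - f_equal; auto.
Qed.

Lemma rename_rename t xi zeta :
  rename xi (rename zeta t) = rename (fun n => xi (zeta n)) t.
Proof. now rewrite (rename_subst _ xi), subst_rename, <- rename_subst. Qed.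

Lemma rename_of_subst t : forall xi sigma,
  rename xi (subst sigma t) = subst (fun n => rename xi (sigma n)) t.
Proof.
  assert (up : forall xi sigma n,
            up_sub (fun m => rename xi (sigma m)) n
            = rename (up_ren xi) (up_sub sigma n))
    by (intros xi sigma [|n]; simpl; now rewrite ?rename_rename).
  induction t as [n|c Ms IH| | |A B IHA IHB|A M IHA IHM|M N IHM IHN]
    using term_list_ind; intros xi sigma; simpl; auto.
  - f_equal; rewrite map_map; apply map_ext_Forall; revert IH; apply Forall_impl; auto.
  - f_equal; auto; rewrite IHB; apply subst_ext; intros; now rewrite up.
  - f_equal; auto; rewrite IHM; apply subst_ext; intros; now rewrite up.
  - f_equal; auto.
Qed.

(** Under a binder [up_sub] shifts by [rename], so the composition law rests on both mixed laws,
    [rename_of_subst] and [subst_rename]. *)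
Lemma subst_subst t : forall sigma tau,
  subst tau (subst sigma t) = subst (fun n => subst tau (sigma n)) t.
Proof.
  assert (up : forall sigma tau n,
            up_sub (fun m => subst tau (sigma m)) n
            = subst (up_sub tau) (up_sub sigma n)).
  { intros sigma tau [|n]; simpl; auto.
    rewrite rename_of_subst, subst_rename; now apply subst_ext. }
  induction t as [n|c Ms IH| | |A B IHA IHB|A M IHA IHM|M N IHM IHN]
    using term_list_ind; intros sigma tau; simpl; auto.
  - f_equal; rewrite map_map; apply map_ext_Forall; revert IH; apply Forall_impl; auto.
  - f_equal; auto; rewrite IHB; apply subst_ext; intros; now rewrite up.
  - f_equal; auto; rewrite IHM; apply subst_ext; intros; now rewrite up.
  - f_equal; auto.
Qed.

Lemma subst_Var t : forall sigma, (forall n, sigma n = Var n) -> subst sigma t = t.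
Proof.
  assert (up : forall sigma, (forall n, sigma n = Var n) ->
                 forall n, up_sub sigma n = Var n)
    by (intros sigma H [|n]; simpl; now rewrite ?H).
  induction t as [n|c Ms IH| | |A B IHA IHB|A M IHA IHM|M N IHM IHN]
    using term_list_ind; intros sigma H; simpl; auto.
  - f_equal; rewrite <- (map_id Ms) at 2; apply map_ext_Forall; revert IH;
      apply Forall_impl; auto.
  - f_equal; auto.
  - f_equal; auto.
  - f_equal; auto.
Qed.

Lemma subst_subst1 sigma M N :
  subst sigma (subst1 M N) = subst1 (subst (up_sub sigma) M) (subst sigma N).
Proof.
  unfold subst1; rewrite !subst_subst; apply subst_ext.
  intros [|n]; simpl; auto.
  rewrite subst_rename, subst_Var; auto.
Qed.

Lemma rename_subst1 xi M N :
  rename xi (subst1 M N) = subst1 (rename (up_ren xi) M) (rename xi N).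
Proof.
  rewrite !rename_subst, subst_subst1; f_equal.
  apply subst_ext; intros [|n]; reflexivity.
Qed.

(* A semantic notion: [t] only depends on the variables below [k]. *)
Definition scoped (k : nat) (t : term C) : Prop :=
  forall sigma tau, (forall n, n < k -> sigma n = tau n) ->
  subst sigma t = subst tau t.

Fixpoint scoped_ctx (Delta : ctx C) : Prop :=
  match Delta with
  | [] => True
  | A :: Delta' => scoped (length Delta') A /\ scoped_ctx Delta'
  end.

(** The bound matters: past the end of [Ms], [args_sub] returns variables, which [rename] could
    move. The induction peels off the last argument, the one that index 0 selects. *)
Lemma rename_args_sub xi Ms : forall n, n < length Ms ->
  rename xi (args_sub Ms n) = args_sub (map (rename xi) Ms) n.
Proof.
  unfold args_sub.
  induction Ms as [|M Ms IH] using rev_ind; intros n Hn; simpl in Hn; [lia|].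
  rewrite map_app, !fold_left_app; simpl.
  rewrite length_app in Hn; simpl in Hn.
  destruct n as [|n]; simpl; auto; apply IH; lia.
Qed.

Lemma rename_subst_args xi Ms A : scoped (length Ms) A ->
  rename xi (subst (args_sub Ms) A) = subst (args_sub (map (rename xi) Ms)) A.
Proof.
  intros HA; rewrite rename_of_subst; apply HA.
  intros n Hn; now apply rename_args_sub.
Qed.

End Substitution.

(** * Conversion *)

Section Conversion.

Variables (C : Type) (T : theory C).

Local Notation step := (compat (union _ beta_root (rule_root T))).

(** Serves both for one-hole term contexts, giving the congruence lemmas, and for substitutions. *)
Lemma conv_map (f : term C -> term C) :
  (forall M N, step M N -> step (f M) (f N)) ->
  forall M N, conv T M N -> conv T (f M) (f N).
Proof.
  intros Hf M N H; induction H; unfold conv in *; eauto using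
    rst_step, rst_refl, rst_sym, rst_trans.
Qed.

Lemma conv_Pi A A' B B' : conv T A A' -> conv T B B' -> conv T (Pi A B) (Pi A' B').
Proof.
  intros HA HB; eapply rst_trans.
  - apply (@conv_map (fun X => Pi X B)); eauto using compat.
  - apply (@conv_map (Pi A')); eauto using compat.
Qed.

Lemma conv_Lam A A' B B' : conv T A A' -> conv T B B' -> conv T (Lam A B) (Lam A' B').
Proof.
  intros HA HB; eapply rst_trans.
  - apply (@conv_map (fun X => Lam X B)); eauto using compat.
  - apply (@conv_map (Lam A')); eauto using compat.
Qed.

Lemma conv_App A A' B B' : conv T A A' -> conv T B B' -> conv T (App A B) (App A' B').
Proof.
  intros HA HB; eapply rst_trans.
  - apply (@conv_map (fun X => App X B)); eauto using compat.
  - apply (@conv_map (App A')); eauto using compat.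
Qed.

Lemma conv_Cst c Ms Ns : Forall2 (conv T) Ms Ns -> conv T (Cst c Ms) (Cst c Ns).
Proof.
  intros H; rewrite <- (app_nil_l Ms), <- (app_nil_l Ns).
  (* The prefix [Ls] collects the arguments already converted, so that each round changes a single
     position. *)
  generalize (@nil (term C)) as Ls; induction H as [|M N Ms Ns HMN _ IH]; intros Ls.
  - apply rst_refl.
  - eapply rst_trans.
    + apply (@conv_map (fun X => Cst c (Ls ++ X :: Ms))); eauto using compat.
    + change (N :: Ms) with ([N] ++ Ms); change (N :: Ns) with ([N] ++ Ns).
      rewrite !app_assoc; apply IH.
Qed.

Lemma step_subst M N : step M N -> forall sigma, step (subst sigma M) (subst sigma N).
Proof.
  induction 1 as [M N [[A M' N']|[l r tau Hr]]| | | | | | |]; intros sigma;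
    simpl; rewrite ?map_app; simpl; auto using compat.
  - apply compat_root; left; rewrite subst_subst1; constructor.
  - apply compat_root; right; rewrite !subst_subst; now constructor.
Qed.

Lemma conv_rename xi M N : conv T M N -> conv T (rename xi M) (rename xi N).
Proof.
  rewrite !rename_subst; apply conv_map; intros; now apply step_subst.
Qed.

End Conversion.

(** * Weakening and context conversion *)

Scheme dk_wf_mut := Minimality for dk_wf Sort Prop
  with dk_typing_mut := Minimality for dk_typing Sort Prop
  with dk_args_mut := Minimality for dk_args Sort Prop.
Combined Scheme dk_mutind from dk_wf_mut, dk_typing_mut, dk_args_mut.

Section Typing.

Variables (C : Type) (T : theory C).

Lemma dk_args_length G Ms Delta : dk_args T G Ms Delta -> length Ms = length Delta.
Proof.
  induction 1; simpl; auto; rewrite length_app; simpl; lia.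
Qed.

(** Declared types depend on their parameters alone, so weakening acts on the arguments of a
    constant and leaves its declaration as it is. *)
Hypothesis sig_scoped : forall c Delta A,
  sig T c Delta A -> scoped_ctx Delta /\ scoped (length Delta) A.

(** The equation compares the lifted types, that is, those which [dk_Var] assigns to [Var (xi n)] in
    [G'] and to [Var n] in [G]. *)
Definition ren_ok (xi : nat -> nat) (G G' : ctx C) : Prop :=
  dk_wf T G' /\
  forall n A, nth_error G n = Some A ->
  exists A', nth_error G' (xi n) = Some A' /\
    rename (Nat.add (S (xi n))) A' = rename xi (rename (Nat.add (S n)) A).

Lemma ren_ok_up xi G G' A : ren_ok xi G G' -> dk_typing T G' (rename xi A) TYPE ->
  ren_ok (up_ren xi) (A :: G) (rename xi A :: G').
Proof.
  intros [_ H] HA; split; [now constructor|].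
  intros [|n] B HB; simpl in *.
  - injection HB as <-; eexists; split; [reflexivity|].
    now rewrite !rename_rename.
  - destruct (H _ _ HB) as (B' & HB' & E); exists B'; split; auto.
    apply (f_equal (rename S)) in E; rewrite !rename_rename in *; exact E.
Qed.

Lemma dk_typing_rename G M A : dk_typing T G M A ->
  forall xi G', ren_ok xi G G' -> dk_typing T G' (rename xi M) (rename xi A).
Proof.
  enough (H : (forall G, dk_wf T G -> True) /\
              (forall G M A, dk_typing T G M A -> forall xi G', ren_ok xi G G' ->
                 dk_typing T G' (rename xi M) (rename xi A)) /\
              (forall G Ms Delta, dk_args T G Ms Delta -> scoped_ctx Delta ->
                 forall xi G', ren_ok xi G G' ->
                 dk_args T G' (map (rename xi) Ms) Delta))
    by (destruct H as (_ & H & _); eauto).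
  assert (rename_sort : forall xi s, is_sort s -> rename xi s = s :> term C)
    by (intros xi s [-> | ->]; reflexivity).
  apply dk_mutind; auto; clear G M A.
  - intros G n A _ _ HA xi G' [wf' H].
    destruct (H _ _ HA) as (A' & HA' & <-); now apply dk_Var.
  - intros G c Delta A s Ms Hc Hs HA _ HMs IH xi G' H.
    destruct (sig_scoped _ _ _ Hc) as [HDelta HAs].
    rewrite rename_subst_args by (now rewrite (dk_args_length HMs)).
    apply dk_Cst with Delta s; auto.
  - intros G _ _ xi G' [wf' _]; now apply dk_Sort.
  - intros G A B s Hs _ IHA _ IHB xi G' H.
    rewrite (rename_sort xi s) by auto; simpl.
    pose proof (IHA xi G' H) as HA'; pose proof (IHB _ _ (ren_ok_up _ H HA')) as HB'.
    rewrite (rename_sort _ s Hs) in HB'; now apply dk_Pi.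
  - intros G A B M s Hs _ IHA _ IHB _ IHM xi G' H.
    pose proof (IHA xi G' H) as HA'; pose proof (IHB _ _ (ren_ok_up _ H HA')) as HB'.
    rewrite (rename_sort _ s Hs) in HB'.
    apply dk_Lam with s; auto using ren_ok_up.
  - intros G A B M N _ IHM _ IHN xi G' H.
    rewrite rename_subst1; apply dk_App with (rename xi A); auto.
  - intros G M A B s Hs _ IHM _ IHB HAB xi G' H.
    apply dk_Conv with (rename xi A) s; auto using conv_rename.
    rewrite <- (rename_sort xi s); auto.
  - intros G _ _ _ xi G' [wf' _]; now apply dk_args_nil.
  - intros G Ms Delta M A HMs IHMs _ IHM [HA HDelta] xi G' H.
    rewrite map_app; simpl; apply dk_args_snoc; auto.
    rewrite <- rename_subst_args by (now rewrite (dk_args_length HMs)); auto.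
Qed.

Lemma dk_typing_weaken G M A X : dk_typing T G M A -> dk_typing T G X TYPE ->
  dk_typing T (X :: G) (rename S M) (rename S A).
Proof.
  intros HM HX; apply (dk_typing_rename HM); split; [now constructor|].
  intros n B HB; exists B; split; auto; now rewrite rename_rename.
Qed.

(** Each variable must be typable at its old type, possibly through [dk_Conv]; its context entry may
    thus change up to conversion. This is the identity seen as a well-typed substitution. *)
Definition ctx_retypes (G G' : ctx C) : Prop :=
  dk_wf T G' /\
  forall n A, nth_error G n = Some A ->
  dk_typing T G' (Var n) (rename (Nat.add (S n)) A).

Lemma ctx_retypes_cons G G' A : ctx_retypes G G' -> dk_typing T G' A TYPE ->
  ctx_retypes (A :: G) (A :: G').
Proof.
  intros [_ H] HA; split; [now constructor|].
  intros [|n] B HB; simpl in HB.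
  - apply dk_Var; auto; now constructor.
  - specialize (dk_typing_weaken (H _ _ HB) HA); simpl; now rewrite rename_rename.
Qed.

Lemma dk_typing_retype G M A : dk_typing T G M A ->
  forall G', ctx_retypes G G' -> dk_typing T G' M A.
Proof.
  enough (H : (forall G, dk_wf T G -> True) /\
              (forall G M A, dk_typing T G M A -> forall G', ctx_retypes G G' ->
                 dk_typing T G' M A) /\
              (forall G Ms Delta, dk_args T G Ms Delta ->
                 forall G', ctx_retypes G G' -> dk_args T G' Ms Delta))
    by (destruct H as (_ & H & _); eauto).
  apply dk_mutind; auto; clear G M A.
  - intros G n A _ _ HA G' [_ H]; auto.
  - intros; econstructor; eauto.
  - intros G _ _ G' [wf' _]; now constructor.
  - intros; econstructor; eauto using ctx_retypes_cons.
  - intros; econstructor; eauto using ctx_retypes_cons.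
  - intros; econstructor; eauto.
  - intros; econstructor; eauto.
  - intros G _ _ G' [wf' _]; now constructor.
  - intros; econstructor; eauto.
Qed.

(** Only index 0 changes its entry, and [dk_Conv] brings it back to the type [A'], weakened into the
    new context. *)
Lemma dk_typing_conv_head G A A' M B :
  dk_typing T G A TYPE -> dk_typing T G A' TYPE -> conv T A A' ->
  dk_typing T (A' :: G) M B -> dk_typing T (A :: G) M B.
Proof.
  intros HA HA' HAA' HM; apply (dk_typing_retype HM).
  assert (wf : dk_wf T (A :: G)) by now constructor.
  split; auto.
  intros [|n] X HX; simpl in HX.
  - injection HX as ->.
    apply dk_Conv with (A := rename (Nat.add 1) A) (s := TYPE).
    + now left.
    + now apply dk_Var.
    + exact (dk_typing_weaken HA' HA).
    + now apply conv_rename.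
  - now apply dk_Var.
Qed.

(** * Inversion of typing for products and abstractions *)

Lemma dk_Pi_inv G A B X : dk_typing T G (Pi A B) X ->
  dk_typing T G A TYPE /\ exists s, is_sort s /\ dk_typing T (A :: G) B s.
Proof.
  intros H; remember (Pi A B) as M eqn:E; revert A B E.
  induction H; intros A0 B0 E; try discriminate E; eauto.
  injection E as -> ->; eauto.
Qed.

Lemma dk_Lam_inv G A M X : dk_typing T G (Lam A M) X ->
  exists B, dk_typing T G A TYPE /\ dk_typing T (A :: G) M B /\ conv T (Pi A B) X.
Proof.
  intros H; remember (Lam A M) as L eqn:E; revert A M E.
  induction H; intros A0 M0 E; try discriminate E.
  - injection E as -> ->; exists B; repeat split; auto; apply rst_refl.
  - destruct (IHdk_typing1 _ _ E) as (B' & HA & HM & HB').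
    exists B'; repeat split; auto; eapply rst_trans; eauto.
Qed.

(** The last rule is either [dk_Lam], whose premises type both components, or [dk_Conv], which types
    the product itself and leaves the rest to [dk_Pi_inv]. *)
Lemma dk_Lam_type_Pi G L M A B : dk_typing T G (Lam L M) (Pi A B) ->
  dk_typing T G A TYPE /\ exists s, is_sort s /\ dk_typing T (A :: G) B s.
Proof.
  intros H; inversion H; subst; eauto using dk_Pi_inv.
Qed.

End Typing.

(** * Confluence *)

Section Confluence.

Variable P : pts_spec.

Local Notation T := (epts_theory P).
Local Notation tm := (term (econst (sort P))).

(** Parallel reduction contracts any set of redexes of the term at once. The rule for [capp] is
    left-linear: the annotations [A], [B] and [A'], [B'] are independent, so reducing one of them
    never destroys the redex. *)
Inductive par : tm -> tm -> Prop :=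
| par_Var n : par (Var n) (Var n)
| par_TYPE : par TYPE TYPE
| par_KIND : par KIND KIND
| par_Cst c Ms Ns : pars Ms Ns -> par (Cst c Ms) (Cst c Ns)
| par_Pi A A' B B' : par A A' -> par B B' -> par (Pi A B) (Pi A' B')
| par_Lam A A' M M' : par A A' -> par M M' -> par (Lam A M) (Lam A' M')
| par_App M M' N N' : par M M' -> par N N' -> par (App M N) (App M' N')
| par_beta A M M' N N' : par M M' -> par N N' ->
    par (App (Lam A M) N) (subst1 M' N')
| par_rule_El s1 s2 : axiom P s1 s2 -> par (tEl s2 (tu s1)) (tU s1)
| par_rule_app s1 s2 s3 A B A' B' M M' N N' : prod_rule P s1 s2 s3 ->
    par M M' -> par N N' ->
    par (tapp s1 s2 A B (tabs s1 s2 A' B' M) N) (App M' N')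

with pars : list tm -> list tm -> Prop :=
| pars_nil : pars [] []
| pars_cons M M' Ms Ms' : par M M' -> pars Ms Ms' -> pars (M :: Ms) (M' :: Ms').

Scheme par_mut := Minimality for par Sort Prop
  with pars_mut := Minimality for pars Sort Prop.
Combined Scheme par_mutind from par_mut, pars_mut.

Hint Constructors par pars : core.

Lemma par_refl M : par M M.
Proof.
  induction M using term_list_ind; auto.
  constructor; induction H; auto.
Qed.

Lemma pars_refl Ms : pars Ms Ms.
Proof. induction Ms; auto using par_refl. Qed.

Hint Resolve par_refl pars_refl : core.

Lemma par_rename M M' : par M M' -> forall xi, par (rename xi M) (rename xi M').
Proof.
  enough (H : (forall M M', par M M' -> forall xi, par (rename xi M) (rename xi M')) /\
              (forall Ms Ms', pars Ms Ms' -> forall xi,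
                 pars (map (rename xi) Ms) (map (rename xi) Ms')))
    by (destruct H; auto).
  apply par_mutind; simpl; auto; clear M M'.
  - intros A M M' N N' _ IHM _ IHN xi; rewrite rename_subst1; auto.
  - intros s1 s2 H xi; apply par_rule_El; auto.
  - intros; eapply par_rule_app; eauto.
Qed.

Lemma par_up sigma sigma' : (forall n, par (sigma n) (sigma' n)) ->
  forall n, par (up_sub sigma n) (up_sub sigma' n).
Proof. intros H [|n]; simpl; auto using par_rename. Qed.

Lemma par_subst M M' : par M M' -> forall sigma sigma',
  (forall n, par (sigma n) (sigma' n)) -> par (subst sigma M) (subst sigma' M').
Proof.
  enough (H : (forall M M', par M M' -> forall sigma sigma',
                 (forall n, par (sigma n) (sigma' n)) ->
                 par (subst sigma M) (subst sigma' M')) /\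
              (forall Ms Ms', pars Ms Ms' -> forall sigma sigma',
                 (forall n, par (sigma n) (sigma' n)) ->
                 pars (map (subst sigma) Ms) (map (subst sigma') Ms')))
    by (destruct H; auto).
  apply par_mutind; simpl; auto using par_up; clear M M'.
  - intros A M M' N N' _ IHM _ IHN sigma sigma' H.
    rewrite subst_subst1; auto using par_up.
  - intros s1 s2 H sigma sigma' _; apply par_rule_El; auto.
  - intros; eapply par_rule_app; eauto.
Qed.

Lemma par_subst1 M M' N N' : par M M' -> par N N' ->
  par (subst1 M N) (subst1 M' N').
Proof. intros HM HN; apply par_subst; auto; intros [|n]; simpl; auto. Qed.

Hint Resolve par_subst1 : core.

(** Reducts of [Lam], [tu] and [tabs] keep their head; inverting these steps shows that a redex
    reduced inside is still a redex. *)
Ltac inv_par :=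
  repeat match goal with
  | H : pars [] _ |- _ => inversion H; clear H; subst
  | H : pars (_ :: _) _ |- _ => inversion H; clear H; subst
  | H : par (Lam _ _) _ |- _ => inversion H; clear H; subst
  | H : par (tu _) _ |- _ => inversion H; clear H; subst
  | H : par (tabs _ _ _ _ _) _ |- _ => inversion H; clear H; subst
  | H : par (Cst (cabs _ _) _) _ |- _ => inversion H; clear H; subst
  end.

(** By orthogonality the only delicate pairs oppose a root contraction to a congruence step on the
    same redex; contracting the residual redex closes them. *)
Lemma par_diamond M M1 : par M M1 ->
  forall M2, par M M2 -> exists M3, par M1 M3 /\ par M2 M3.
Proof.
  enough (H : (forall M M1, par M M1 ->
                 forall M2, par M M2 -> exists M3, par M1 M3 /\ par M2 M3) /\
              (forall Ms Ms1, pars Ms Ms1 ->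
                 forall Ms2, pars Ms Ms2 -> exists Ms3, pars Ms1 Ms3 /\ pars Ms2 Ms3))
    by (destruct H; eauto).
  apply par_mutind; clear M M1.
  - inversion 1; subst; eauto.
  - inversion 1; subst; eauto.
  - inversion 1; subst; eauto.
  - intros c Ms Ns HMs IH M2 H2; inversion H2; subst.
    + destruct (IH _ H3) as (Ls & ? & ?); eauto.
    + inv_par; exists (tU s1); split; auto; now apply par_rule_El.
    (* The root contraction is imitated on the argument list by reducing only [M] and [N], so that
       the induction hypothesis for lists joins it with [Ns]. *)
    + destruct (IH [A; B; tabs s1 s2 A' B' M'; N']) as (Ls & HLs1 & HLs2).
      { unfold tabs; auto 10. }
      inv_par.
      match goal with
      | H : par M' ?m, K : par N' ?n |- _ =>
          exists (App m n); split; [eapply par_rule_app|]; eauto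
      end.
  - intros A A' B B' _ IHA _ IHB M2 H2; inversion H2; subst.
    destruct (IHA _ H1) as (? & ? & ?), (IHB _ H4) as (? & ? & ?); eauto.
  - intros A A' B B' _ IHA _ IHB M2 H2; inversion H2; subst.
    destruct (IHA _ H1) as (? & ? & ?), (IHB _ H4) as (? & ? & ?); eauto.
  - intros M M' N N' HM IHM _ IHN M2 H2; inversion H2; subst.
    + destruct (IHM _ H1) as (? & ? & ?), (IHN _ H4) as (? & ? & ?); eauto.
    (* Likewise, the beta contraction is imitated in the function part by reducing only the body. *)
    + destruct (IHM (Lam A M'0)) as (L & HL1 & HL2); auto.
      destruct (IHN _ H4) as (K & ? & ?).
      inv_par; eauto.
  - intros A M M' N N' _ IHM _ IHN M2 H2; inversion H2; subst.
    + inv_par.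
      destruct (IHM _ H6) as (? & ? & ?), (IHN _ H4) as (? & ? & ?); eauto.
    + destruct (IHM _ H4) as (? & ? & ?), (IHN _ H5) as (? & ? & ?); eauto.
  - intros s1 s2 H M2 H2; inversion H2; subst; eauto.
    inv_par; exists (tU s1); split; auto; now apply par_rule_El.
  - intros s1 s2 s3 A B A' B' M M' N N' H _ IHM _ IHN M2 H2; inversion H2; subst.
    + inv_par.
      match goal with
      | H : par M ?m, K : par N ?n |- _ =>
          destruct (IHM _ H) as (M3 & ? & ?), (IHN _ K) as (N3 & ? & ?)
      end.
      exists (App M3 N3); split; [|eapply par_rule_app]; eauto.
    + match goal with
      | H : par M ?m, K : par N ?n |- context [App ?m ?n] =>
          destruct (IHM _ H) as (? & ? & ?), (IHN _ K) as (? & ? & ?)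
      end.
      eauto.
  - inversion 1; subst; eauto.
  - intros M M' Ms Ms' _ IHM _ IHMs Ms2 H2; inversion H2; subst.
    destruct (IHM _ H1) as (? & ? & ?), (IHMs _ H4) as (? & ? & ?); eauto.
Qed.

(** * Confluence, the Church-Rosser property and injectivity of products *)

Local Notation red := (clos_refl_trans_1n _ par).

Lemma red_strip M M1 M2 : red M M1 -> par M M2 -> exists M3, par M1 M3 /\ red M2 M3.
Proof.
  intros H; revert M2; induction H as [|M L M1 HML _ IH]; intros M2 HM2.
  - exists M2; split; auto; constructor.
  - destruct (par_diamond HML HM2) as (K & HLK & HM2K).
    destruct (IH _ HLK) as (M3 & ? & ?).
    exists M3; split; auto; econstructor; eauto.
Qed.

Lemma red_confluent M M1 M2 : red M M1 -> red M M2 -> exists M3, red M1 M3 /\ red M2 M3.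
Proof.
  intros H1 H2; revert M1 H1; induction H2 as [|M L M2 HML _ IH]; intros M1 HM1.
  - exists M1; split; auto; constructor.
  - destruct (red_strip HM1 HML) as (K & HK1 & HK2).
    destruct (IH _ HK2) as (M3 & ? & ?).
    exists M3; split; auto; econstructor; eauto.
Qed.

Lemma red_trans L M N : red L M -> red M N -> red L N.
Proof. induction 1; auto; econstructor; eauto. Qed.

(** Together with [par_conv], this places [par] between one-step reduction and conversion, so
    confluence of [red] carries over to [conv]. *)
Lemma step_par M N : compat (union _ beta_root (rule_root T)) M N -> par M N.
Proof.
  induction 1 as [M N [[A M' N']|[l r sigma Hr]]|c Ms M M' Ns _ IH| | | | | |]; auto.
  - destruct Hr; simpl; [now apply par_rule_El|eapply par_rule_app; eauto].
  - constructor; induction Ms; simpl; auto.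
Qed.

Lemma church_rosser M N : conv T M N -> exists L, red M L /\ red N L.
Proof.
  induction 1 as [M N H|M|M N _ [L [? ?]]|K M N _ [L1 [? HM1]] _ [L2 [HM2 ?]]].
  - exists N; split; [econstructor; [apply step_par; eauto|]|]; constructor.
  - exists M; split; constructor.
  - eauto.
  - destruct (red_confluent HM1 HM2) as (L & ? & ?).
    exists L; split; eauto using red_trans.
Qed.

Lemma par_conv M N : par M N -> conv T M N.
Proof.
  enough (H : (forall M N, par M N -> conv T M N) /\
              (forall Ms Ns, pars Ms Ns -> Forall2 (conv T) Ms Ns))
    by (destruct H; auto).
  apply par_mutind; auto using rst_refl, conv_Cst, conv_Pi, conv_Lam, conv_App;
    try (intros; apply rst_refl); clear M N.
  - intros A M M' N N' _ IHM _ IHN.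
    apply rst_trans with (App (Lam A M') N').
    + apply conv_App; auto; apply conv_Lam; auto; apply rst_refl.
    + apply rst_step, compat_root; left; constructor.
  - intros s1 s2 H; apply rst_step, compat_root; right.
    (* The rule for [El] is closed, so the identity substitution gives the instance. *)
    apply (rule_root_intro T _ _ Var (rule_El P s1 s2 H)).
  - intros s1 s2 s3 A B A' B' M M' N N' H _ IHM _ IHN.
    apply rst_trans with (App M N); [|now apply conv_App].
    apply rst_step, compat_root; right.
    (* The list gives the values of the pattern variables 0 to 5 of the rule, in order; [Var 0] is
       only the default beyond them. *)
    apply (rule_root_intro T _ _ (fun n => nth n [A; B; A'; B'; M; N] (Var 0))
             (rule_app P s1 s2 s3 H)).
Qed.

Lemma red_conv M N : red M N -> conv T M N.
Proof.
  induction 1 as [|M L N HML _ IH]; [apply rst_refl|].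
  eapply rst_trans; [apply par_conv, HML|exact IH].
Qed.

(** No redex has [Pi] at its root, so every step takes place inside the components. *)
Lemma red_Pi A B L : red (Pi A B) L -> exists A' B', L = Pi A' B' /\ red A A' /\ red B B'.
Proof.
  intros H; remember (Pi A B) as M eqn:E; revert A B E.
  induction H as [|M N L HMN _ IH]; intros A B ->.
  - exists A, B; repeat split; constructor.
  - inversion HMN; subst.
    destruct (IH _ _ eq_refl) as (A2 & B2 & -> & ? & ?).
    exists A2, B2; repeat split; econstructor; eauto.
Qed.

(** A common reduct of the two products is a product, whose components are common reducts of
    theirs. *)
Lemma conv_Pi_inj A B A' B' : conv T (Pi A B) (Pi A' B') -> conv T A A' /\ conv T B B'.
Proof.
  intros H; destruct (church_rosser H) as (L & H1 & H2).
  destruct (red_Pi H1) as (A1 & B1 & -> & HA1 & HB1).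
  destruct (red_Pi H2) as (A2 & B2 & E & HA2 & HB2).
  injection E as -> ->.
  split; (eapply rst_trans; [|apply rst_sym]); apply red_conv; eassumption.
Qed.

(* Excludes [capp], the only constant whose rule may produce a different kind
   of head. *)
Definition rigid (M : tm) : Prop :=
  match M with
  | TYPE | KIND => True
  | Cst (capp _ _) _ => False
  | Cst _ _ => True
  | _ => False
  end.

Lemma rigid_rename xi M : rigid M -> rigid (rename xi M).
Proof. destruct M; simpl; auto. Qed.

Lemma rigid_subst sigma M : rigid M -> rigid (subst sigma M).
Proof. destruct M; simpl; tauto. Qed.

(** The only root contraction of a rigid term rewrites [El] applied to [u] into [U], which is rigid
    again. *)
Lemma rigid_red M N : red M N -> rigid M -> rigid N.
Proof.
  induction 1 as [|M L N HML _ IH]; auto.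
  intros HM; apply IH; inversion HML; subst; simpl in *; tauto.
Qed.

Lemma rigid_not_conv_Pi M A B : rigid M -> ~ conv T M (Pi A B).
Proof.
  intros HM H; destruct (church_rosser H) as (L & H1 & H2).
  destruct (red_Pi H2) as (A' & B' & -> & _).
  exact (rigid_red H1 HM).
Qed.

(** * Inhabitants of products *)

(** Discharges the closedness hypothesis [sig_scoped] of weakening for this signature. *)
Lemma epts_sig_scoped c Delta A : epts_sig P c Delta A ->
  scoped_ctx Delta /\ scoped (length Delta) A.
Proof.
  destruct 1; simpl; unfold scoped; repeat split; intros sigma tau Hst; simpl;
    rewrite ?Hst by (simpl; lia); reflexivity.
Qed.

(** Rigidity is asked only up to conversion, which lets the second alternative pass through
    [dk_Conv]. *)
Lemma dk_typing_Lam_or_rigid D M X :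
  Forall rigid D -> beta_normal M -> dk_typing T D M X ->
  (exists A N, M = Lam A N) \/ (exists Y, rigid Y /\ conv T Y X).
Proof.
  intros HD HM H; revert HD HM.
  induction H as [D n A _ HA|D c Delta A s Ms Hc _ _ _ _|D|D A B s Hs _ _ _ _| |
                  D A B M N _ IHM _ _|D M A B s _ _ IHM _ _ HAB];
    intros HD HM; eauto.
  - right; eexists; split; [|apply rst_refl].
    apply rigid_rename; rewrite Forall_forall in HD.
    apply HD; eapply nth_error_In; eauto.
  - right; eexists; split; [|apply rst_refl].
    (* Every declared type is [TYPE] or is headed by [U] or [El]. *)
    apply rigid_subst; destruct Hc; simpl; auto.
  - right; exists KIND; split; [exact I|apply rst_refl].
  - right; exists s; split; [destruct Hs as [-> | ->]; exact I|apply rst_refl].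
  (* The head of the application has a product type: if an abstraction, it forms a beta-redex;
     otherwise a rigid type would be convertible to a product. *)
  - exfalso.
    assert (HM' : beta_normal M)
      by (intros M' HM'; apply (HM (App M' N)); now constructor).
    destruct (IHM HD HM') as [(A' & N' & ->)|(Y & HY & HYX)].
    + apply (HM (subst1 N' N)); now repeat constructor.
    + exact (rigid_not_conv_Pi HY HYX).
  - destruct (IHM HD HM) as [?|(Y & HY & HYA)]; auto.
    right; exists Y; split; auto; eapply rst_trans; eauto.
Qed.

Lemma ctx_tr_rigid G D : ctx_tr P G D -> Forall rigid D.
Proof. induction 1; constructor; auto; exact I. Qed.

End Confluence.

Theorem mainTheorem15 (P : pts_spec) (hP : functional P)
    (G : ectx (sort P)) (hG : epts_wf P G)
    (D : ctx (econst (sort P))) (hD : ctx_tr P G D)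
    (M A B : term (econst (sort P))) (hM : beta_normal M)
    (hT : dk_typing (epts_theory P) D M (Pi A B)) :
  exists A' N : term (econst (sort P)),
    M = Lam A' N /\
    conv (epts_theory P) A' A /\
    dk_typing (epts_theory P) (A :: D) N B.
Proof.
  destruct (dk_typing_Lam_or_rigid (ctx_tr_rigid hD) hM hT)
    as [(A' & N & ->)|(Y & HY & HYX)].
  2: { destruct (rigid_not_conv_Pi HY HYX). }
  exists A', N; split; auto.
  destruct (dk_Lam_inv hT) as (B' & HA' & HN & HPi).
  destruct (conv_Pi_inj HPi) as [HAA' HBB'].
  destruct (dk_Lam_type_Pi hT) as [HA (s & Hs & HB)].
  split; auto.
  (* The body has type [B'] under [A']. The bound type is changed to [A], and [HB], which types [B]
     under [A], allows the conversion from [B'] to [B]. *)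
  apply dk_Conv with B' s; auto.
  apply dk_typing_conv_head with A'; auto.
  - exact (@epts_sig_scoped P).
  - now apply rst_sym.
Qed.
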